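(* Let $\beta,\psi_0,M$ be real constants, $\kappa>0$, $p\in\mathbb{R}\setminus\{0,-\tfrac12\}$, and let $I\subset(0,\infty)$ be an open interval on which $f(r):=\frac{1}{2p+1}-2Mr^{-2p-1}>0$. Set $\tilde{\mathcal{C}}\equiv0$, $\mathcal{V}\equiv0$, $\mathcal{A}(\psi)=-\frac{p\beta}{4}\psi^2$, and $$A(r)=\sqrt{f(r)},\qquad C(r)=1,\qquad \psi(r)=\psi_0r^p .$$ Then $E^{(2)}_{tt}=E^{(2)}_{rr}=E^{(2)}_{\vartheta\vartheta}=E^{(2)}_{\psi}=0$ hold on $I$, i.e. the metric ${\rm d}s^2=f\,{\rm d}t^2-f^{-1}{\rm d}r^2-r^2{\rm d}\Omega^2$ with this scalar field solves the complex-tetrad vacuum field equations.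
   Context: Metric ansatz ${\rm d}s^2=A(r)^2{\rm d}t^2-\frac{C(r)^2}{A(r)^2}{\rm d}r^2-r^2{\rm d}\Omega^2$, scalar field $\psi=\psi(r)$. Primes on $A,C,\psi$ are $r$-derivatives; $\mathcal{A}',\tilde{\mathcal{C}}',\tilde{\mathcal{C}}'',\mathcal{V}'$ are $\psi$-derivatives evaluated at $\psi(r)$. The complex-tetrad reduced vacuum field equations of the scalar-torsion theory are: $E^{(2)}_{tt}:\ 0=\mathcal{A}\frac{A^2(-2rACA'-A^2(C-2rC')+C^3)}{r^2C^3}+\tilde{\mathcal{C}}'\frac{A^3(C(A'\psi'+A\psi'')-AC'\psi')}{C^3}-\frac{2A^4\psi'\mathcal{A}'}{rC^2}+\frac{A^4\psi'^2\tilde{\mathcal{C}}''}{C^2}-\frac{\beta A^4\psi'^2}{2C^2}+\kappa^2A^2\mathcal{V}$; $E^{(2)}_{rr}:\ 0=\frac{\mathcal{A}(-2rAA'-A^2+C^2)}{r^2A^2}+\big(\frac{A'}{A}+\frac2r\big)\psi'\tilde{\mathcal{C}}'+\frac{\kappa^2C^2\mathcal{V}}{A^2}+\frac12\beta\psi'^2$; $E^{(2)}_{\vartheta\vartheta}:\ 0=-\mathcal{A}'\frac{A(rA'+A)\psi'}{rC^2}+\tilde{\mathcal{C}}'\frac{A(C(A'\psi'+A\psi'')-AC'\psi')}{C^3}+\frac{\mathcal{A}(-rCA'^2+A(rA'C'-C(rA''+2A'))+A^2C')}{rC^3}+\frac{A^2\psi'^2\tilde{\mathcal{C}}''}{C^2}-\frac{\beta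 A^2\psi'^2}{2C^2}+\kappa^2\mathcal{V}$; $E^{(2)}_{\psi}:\ 0=\frac{(2rAA'+A^2+C^2)\mathcal{A}'}{r^2C^2}+\frac{\beta A(2rCA'\psi'+A(C(r\psi''+2\psi')-rC'\psi'))}{rC^3}+\frac{\tilde{\mathcal{C}}'(r^2CA'^2+rA(C(rA''+6A')-rA'C')+2A^2(C-rC'))}{r^2C^3}+\kappa^2\mathcal{V}'$. *)

(* Defs.v *)
From Stdlib Require Import Reals.
From Coquelicot Require Import Coquelicot.
Open Scope R_scope.

(* Reduced vacuum field equations of the scalar-torsion theory (complex tetrad),
   for metric functions A, C and scalar field psi (functions of r), and
   coupling functions Acal, Ct (= \tilde C), V (functions of psi).  Each definition is the right-hand side
   of the corresponding equation "0 = ...". *)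

Section FieldEqs.
Variables (Acal Ct V : R -> R) (kappa beta : R) (A C psi : R -> R).

Let A1 r := Derive A r.
Let A2 r := Derive (Derive A) r.
Let C1 r := Derive C r.
Let p1 r := Derive psi r.
Let p2 r := Derive (Derive psi) r.
Let Ac r := Acal (psi r).
Let Ac1 r := Derive Acal (psi r).
Let Ct1 r := Derive Ct (psi r).
Let Ct2 r := Derive (Derive Ct) (psi r).
Let Vv r := V (psi r).
Let V1 r := Derive V (psi r).

Definition E_tt (r : R) : R :=
  Ac r * (A r ^ 2 * (- 2 * r * A r * C r * A1 r - A r ^ 2 * (C r - 2 * r * C1 r)
                      + C r ^ 3) / (r ^ 2 * C r ^ 3))
  + Ct1 r * (A r ^ 3 * (C r * (A1 r * p1 r + A r * p2 r) - A r * C1 r * p1 r)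
             / C r ^ 3)
  - 2 * A r ^ 4 * p1 r * Ac1 r / (r * C r ^ 2)
  + A r ^ 4 * p1 r ^ 2 * Ct2 r / C r ^ 2
  - beta * A r ^ 4 * p1 r ^ 2 / (2 * C r ^ 2)
  + kappa ^ 2 * A r ^ 2 * Vv r.

Definition E_rr (r : R) : R :=
  Ac r * (- 2 * r * A r * A1 r - A r ^ 2 + C r ^ 2) / (r ^ 2 * A r ^ 2)
  + (A1 r / A r + 2 / r) * p1 r * Ct1 r
  + kappa ^ 2 * C r ^ 2 * Vv r / A r ^ 2
  + / 2 * beta * p1 r ^ 2.

Definition E_thth (r : R) : R :=
  - Ac1 r * (A r * (r * A1 r + A r) * p1 r / (r * C r ^ 2))
  + Ct1 r * (A r * (C r * (A1 r * p1 r + A r * p2 r) - A r * C1 r * p1 r)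
             / C r ^ 3)
  + Ac r * (- r * C r * A1 r ^ 2
            + A r * (r * A1 r * C1 r - C r * (r * A2 r + 2 * A1 r))
            + A r ^ 2 * C1 r) / (r * C r ^ 3)
  + A r ^ 2 * p1 r ^ 2 * Ct2 r / C r ^ 2
  - beta * A r ^ 2 * p1 r ^ 2 / (2 * C r ^ 2)
  + kappa ^ 2 * Vv r.

Definition E_psi (r : R) : R :=
  (2 * r * A r * A1 r + A r ^ 2 + C r ^ 2) * Ac1 r / (r ^ 2 * C r ^ 2)
  + beta * A r * (2 * r * C r * A1 r * p1 r
                  + A r * (C r * (r * p2 r + 2 * p1 r) - r * C1 r * p1 r))
    / (r * C r ^ 3)
  + Ct1 r * (r ^ 2 * C r * A1 r ^ 2
             + r * A r * (C r * (r * A2 r + 6 * A1 r) - r * A1 r * C1 r)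
             + 2 * A r ^ 2 * (C r - r * C1 r)) / (r ^ 2 * C r ^ 3)
  + kappa ^ 2 * V1 r.

End FieldEqs.

(* Main.v *)
(* Everything reduces to the linear ODE  r f' + (2p+1) f = 1  solved by
   f = 1/(2p+1) - 2M r^(-2p-1), and to  r psi' = p psi.  Writing f = A^2, the
   derivatives of A are those of f divided by powers of A, and after eliminating
   f' and f'' through the ODE (and its derivative r f'' + (2p+2) f' = 0) each of
   the four field equations becomes a rational identity in A, psi and r. *)

Require Import Defs.
From Stdlib Require Import Reals Lra.
From Coquelicot Require Import Coquelicot.
Open Scope R_scope.

Lemma locally_open_interval (a : R) (b : Rbar) (r : R) :
  a < r -> Rbar_lt r b -> locally r (fun y => a < y /\ Rbar_lt y b).
Proof.
  intros Har Hrb.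
  apply (locally_open (fun y : R => Rbar_lt a y /\ Rbar_lt y b)).
  - apply open_and; [apply open_Rbar_gt | apply open_Rbar_lt].
  - tauto.
  - now split.
Qed.

Lemma is_derive_Rpower (q y : R) :
  0 < y -> is_derive (fun x => Rpower x q) y (q * Rpower y q / y).
Proof.
  intros Hy. unfold Rpower. auto_derive.
  - exact Hy.
  - field. lra.
Qed.

Lemma ex_derive_Rpower (q y : R) : 0 < y -> ex_derive (fun x => Rpower x q) y.
Proof. intros Hy. eexists. apply is_derive_Rpower, Hy. Qed.

Lemma Derive_Rpower_scaled (c q y : R) :
  0 < y -> Derive (fun x => c * Rpower x q) y = q * (c * Rpower y q) / y.
Proof.
  intros Hy. apply is_derive_unique.
  replace (q * (c * Rpower y q) / y) with (c * (q * Rpower y q / y))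
    by (field; lra).
  apply is_derive_scal, is_derive_Rpower, Hy.
Qed.

Lemma Derive2_Rpower_scaled (c q y : R) :
  0 < y -> Derive (Derive (fun x => c * Rpower x q)) y
           = q * (q - 1) * (c * Rpower y q) / y ^ 2.
Proof.
  intros Hy.
  rewrite (Derive_ext_loc _ (fun x => q * (c * Rpower x q) / x)).
  - apply is_derive_unique. auto_derive.
    + repeat split; [now apply ex_derive_Rpower | lra].
    + replace (Derive _ y) with (q * Rpower y q / y)
        by (symmetry; apply is_derive_unique, is_derive_Rpower, Hy).
      field. lra.
  - apply (filter_imp (fun x => 0 < x)); [apply Derive_Rpower_scaled |].
    exact (open_gt 0 y Hy).
Qed.

Lemma Derive_sqrt_comp (g : R -> R) (y : R) :
  0 < g y -> ex_derive g y ->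
  Derive (fun x => sqrt (g x)) y = Derive g y / (2 * sqrt (g y)).
Proof.
  intros Hg Hd. apply is_derive_unique. auto_derive.
  - now repeat split.
  - now rewrite Rmult_1_l.
Qed.

Lemma Derive2_sqrt_comp (g : R -> R) (y : R) :
  locally y (fun x => 0 < g x /\ ex_derive g x) -> ex_derive (Derive g) y ->
  Derive (Derive (fun x => sqrt (g x))) y
  = Derive (Derive g) y / (2 * sqrt (g y))
    - Derive g y ^ 2 / (4 * sqrt (g y) ^ 3).
Proof.
  intros Hloc Hd2.
  destruct (locally_singleton _ _ Hloc) as [Hg Hd].
  rewrite (Derive_ext_loc _ (fun x => Derive g x / (2 * sqrt (g x)))).
  - assert (Hs : 0 < sqrt (g y)) by now apply sqrt_lt_R0.
    apply is_derive_unique. auto_derive.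
    + repeat split; auto; lra.
    + replace (Derive (fun x => Derive g x) y) with (Derive (Derive g) y) by reflexivity.
      replace (Derive (fun x => g x) y) with (Derive g y) by reflexivity.
      field. lra.
  - eapply filter_imp; [| exact Hloc].
    intros x [Hgx Hdx]. now apply Derive_sqrt_comp.
Qed.

Definition metric_fn (p M r : R) : R := / (2 * p + 1) - 2 * M * Rpower r (- 2 * p - 1).

Lemma is_derive_metric_fn (p M y : R) :
  0 < y -> is_derive (metric_fn p M) y
             (2 * M * (2 * p + 1) * Rpower y (- 2 * p - 1) / y).
Proof.
  intros Hy. unfold metric_fn. auto_derive.
  - now apply ex_derive_Rpower.
  - replace (Derive _ y) with ((- 2 * p - 1) * Rpower y (- 2 * p - 1) / y)
      by (symmetry; apply is_derive_unique, is_derive_Rpower, Hy).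
    field. lra.
Qed.

Lemma metric_fn_ode (p M y : R) :
  p <> - / 2 -> 0 < y ->
  y * Derive (metric_fn p M) y + (2 * p + 1) * metric_fn p M y = 1.
Proof.
  intros Hp Hy.
  rewrite (is_derive_unique _ _ _ (is_derive_metric_fn p M y Hy)).
  unfold metric_fn. field. lra.
Qed.

Lemma is_derive_Derive_metric_fn (p M y : R) :
  0 < y -> is_derive (Derive (metric_fn p M)) y
             (- (2 * p + 2) * Derive (metric_fn p M) y / y).
Proof.
  intros Hy.
  set (f1 := fun x => 2 * M * (2 * p + 1) * Rpower x (- 2 * p - 1) / x).
  apply (is_derive_ext_loc f1).
  - apply (filter_imp (fun x => 0 < x)); [| exact (open_gt 0 y Hy)].
    intros x Hx. symmetry. apply is_derive_unique, is_derive_metric_fn, Hx.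
  - rewrite (is_derive_unique _ _ _ (is_derive_metric_fn p M y Hy)).
    unfold f1. auto_derive.
    + repeat split; [now apply ex_derive_Rpower | lra].
    + replace (Derive _ y) with ((- 2 * p - 1) * Rpower y (- 2 * p - 1) / y)
        by (symmetry; apply is_derive_unique, is_derive_Rpower, Hy).
      field. lra.
Qed.

Lemma vacuum_equations_of_derivatives (beta kappa p : R) (A psi : R -> R) (r f1 f2 : R) :
  0 < r -> 0 < A r ->
  Derive A r = f1 / (2 * A r) ->
  Derive (Derive A) r = f2 / (2 * A r) - f1 ^ 2 / (4 * A r ^ 3) ->
  Derive psi r = p * psi r / r ->
  Derive (Derive psi) r = p * (p - 1) * psi r / r ^ 2 ->
  r * f1 + (2 * p + 1) * A r ^ 2 = 1 ->
  r * f2 + (2 * p + 2) * f1 = 0 ->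
  let Acal := fun x : R => - (p * beta / 4) * x ^ 2 in
  let zero := fun _ : R => 0 in
  let one := fun _ : R => 1 in
  E_tt Acal zero zero kappa beta A one psi r = 0 /\
  E_rr Acal zero zero kappa beta A one psi r = 0 /\
  E_thth Acal zero zero kappa beta A one psi r = 0 /\
  E_psi Acal zero zero kappa beta A one psi r = 0.
Proof.
  intros Hr HA HA1 HA2 Hp1 Hp2 Hode Hode' Acal zero one.
  assert (Hzero : forall x, Derive zero x = 0) by (intro; unfold zero; apply Derive_const).
  assert (Hzero2 : forall x, Derive (Derive zero) x = 0).
  { intro x. rewrite (Derive_ext _ (fun _ => 0) x Hzero). apply Derive_const. }
  assert (Hone : forall x, Derive one x = 0) by (intro; unfold one; apply Derive_const).
  assert (HAcal : forall x, Derive Acal x = - (p * beta / 2) * x).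
  { intro x. apply is_derive_unique. unfold Acal. auto_derive; [exact I | field]. }
  unfold E_tt, E_rr, E_thth, E_psi.
  rewrite HA1, HA2, Hp1, Hp2, Hzero, Hzero2, Hone, !HAcal.
  unfold Acal, zero, one.
  (* the ODE determines f' and f'' in terms of A r *)
  replace f2 with (- (2 * p + 2) * f1 / r) by (field_simplify_eq; lra).
  replace f1 with ((1 - (2 * p + 1) * A r ^ 2) / r) by (field_simplify_eq; lra).
  repeat split; field; lra.
Qed.

Theorem mainTheorem7 (beta psi0 M kappa p : R) (a : R) (b : Rbar) :
  0 < kappa -> p <> 0 -> p <> - / 2 ->
  0 <= a -> Rbar_lt a b ->
  (forall r, a < r -> Rbar_lt r b ->
     0 < / (2 * p + 1) - 2 * M * Rpower r (- 2 * p - 1)) ->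
  let f := fun r => / (2 * p + 1) - 2 * M * Rpower r (- 2 * p - 1) in
  let Acal := fun x : R => - (p * beta / 4) * x ^ 2 in
  let Ct := fun _ : R => 0 in
  let V := fun _ : R => 0 in
  let A := fun r => sqrt (f r) in
  let C := fun _ : R => 1 in
  let psi := fun r => psi0 * Rpower r p in
  forall r, a < r -> Rbar_lt r b ->
    E_tt Acal Ct V kappa beta A C psi r = 0 /\
    E_rr Acal Ct V kappa beta A C psi r = 0 /\
    E_thth Acal Ct V kappa beta A C psi r = 0 /\
    E_psi Acal Ct V kappa beta A C psi r = 0.
Proof.
  intros _ _ Hp Ha _ Hf f Acal Ct V A C psi r Har Hrb.
  subst A psi f.
  change (fun r => / (2 * p + 1) - 2 * M * Rpower r (- 2 * p - 1)) with (metric_fn p M) in *.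
  assert (Hr : 0 < r) by lra.
  assert (Hloc : locally r (fun y => 0 < metric_fn p M y /\ ex_derive (metric_fn p M) y)).
  { eapply filter_imp; [| exact (locally_open_interval a b r Har Hrb)].
    intros y [Hay Hyb]. split; [now apply Hf |].
    eexists. apply is_derive_metric_fn. lra. }
  assert (Hfr : 0 < metric_fn p M r) by now apply Hf.
  apply (vacuum_equations_of_derivatives beta kappa p _ _ r
           (Derive (metric_fn p M) r) (Derive (Derive (metric_fn p M)) r)).
  - exact Hr.
  - now apply sqrt_lt_R0.
  - apply Derive_sqrt_comp; [exact Hfr |].
    eexists. now apply is_derive_metric_fn.
  - apply Derive2_sqrt_comp; [exact Hloc |].
    eexists. now apply is_derive_Derive_metric_fn.
  - now apply Derive_Rpower_scaled.
  - now apply Derive2_Rpower_scaled.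
  - rewrite pow2_sqrt by lra. now apply metric_fn_ode.
  - rewrite (is_derive_unique _ _ _ (is_derive_Derive_metric_fn p M r Hr)).
    field. lra.
Qed.
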